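(* Consider the dynamical system on $SO(3)$ given by $$\dot R_{\mathrm e} = -R_{\mathrm e}\,\mathbb{P}_{\mathrm a}(R_{\mathrm e}),\qquad R_{\mathrm e}\in SO(3).$$ The identity $R_{\mathrm e} = I$ is an almost globally asymptotically stable equilibrium of this system.
   Context: $SO(3) = \{R\in\mathbb{R}^{3\times3} \mid RR^\top = I,\ \det R = 1\}$, with $I$ the $3\times3$ identity matrix. For $A\in\mathbb{R}^{3\times3}$, $\mathbb{P}_{\mathrm a}(A) = \frac12(A-A^\top)$ is its skew-symmetric part. A dynamical system is almost globally asymptotically stable (with respect to a specified equilibrium) if that equilibrium is stable (in the sense of Lyapunov) and all trajectories starting in some open dense subset of the state space tend asymptotically to it. *)

(* Defs.v *)
From HB Require Import structures.
From mathcomp Require Import all_boot all_order all_algebra.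
From mathcomp Require Import all_classical all_reals all_analysis.

Set Implicit Arguments.
Unset Strict Implicit.
Unset Printing Implicit Defensive.

Import Order.TTheory GRing.Theory Num.Theory.
Import numFieldNormedType.Exports.

Local Open Scope classical_set_scope.
Local Open Scope ring_scope.

(* Dynamical systems x' = f x whose state space is a subset X of a normed
   space V. *)
Section dynamical_systems.
Context {R : realType} {V : normedModType R}.
Implicit Types (X U : set V) (f : V -> V) (p q : V) (x : R -> V).

(* Only the values x t with 0 <= t are relevant. For f continuous, the
   equation at t = 0 (with the right derivative) follows from the two
   conditions on x. *)
Definition trajectory X f x : Prop :=
  [/\ forall t : R, 0 <= t -> X (x t),
      {within `[0, +oo[, continuous x} &
      forall t : R, 0 < t -> is_derive t 1 x (f (x t))].

Definition forward_complete X f : Prop :=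
  forall q, X q -> exists2 x, trajectory X f x & x 0 = q.

Definition equilibrium X f p : Prop := X p /\ f p = 0.

Definition lyapunov_stable X f p : Prop :=
  forall e : R, 0 < e -> exists2 d : R, 0 < d &
    forall x, trajectory X f x -> `|x 0 - p| < d ->
      forall t : R, 0 <= t -> `|x t - p| < e.

(* Openness and density refer to the subspace topology of X. *)
Definition open_dense_in X U : Prop :=
  (exists2 O : set V, open O & U = X `&` O) /\ X `<=` closure U.

Definition almost_globally_asymptotically_stable X f p : Prop :=
  lyapunov_stable X f p /\
  exists2 U, open_dense_in X U &
    forall x, trajectory X f x -> U (x 0) -> x t @[t --> +oo] --> p.

End dynamical_systems.

Section rotations.
Context {R : realType}.

Definition SO3 : set 'M[R]_3 := [set Q | Q *m Q^T = 1%:M /\ \det Q = 1].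

Definition skew_part (A : 'M[R]_3) : 'M[R]_3 := 2^-1 *: (A - A^T).

Definition attitude_error_field (Q : 'M[R]_3) : 'M[R]_3 :=
  - (Q *m skew_part Q).

End rotations.

(* Main.v *)
Require Import Defs.
From HB Require Import structures.
From mathcomp Require Import all_boot all_order all_algebra.
From mathcomp Require Import all_classical all_reals all_analysis.
From mathcomp Require Import ring lra.

(** On SO(3) the trace [tau] obeys the closed scalar equation
    [tau' = (3 - tau) (1 + tau) / 2], because Cayley-Hamilton reduces [Q^2] to
    [tau Q - tau + Q^T]. Moreover [3 - tau] is half the squared Frobenius
    distance to the identity: it decreases along every trajectory, which gives
    stability, and it decays exponentially as soon as [tau > -1] initially.
    Rotations with [tau > -1] form an open set, dense because a small rotation
    about a coordinate axis increases a trace equal to [-1]. Existence: the flow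
    preserves the rotation axis, and the angle has an explicit evolution. *)

Set Implicit Arguments.
Unset Strict Implicit.
Unset Printing Implicit Defensive.

Import Order.TTheory GRing.Theory Num.Theory.
Import numFieldNormedType.Exports.
Local Open Scope classical_set_scope.
Local Open Scope ring_scope.

(** * Explicit determinants and adjugates in dimension 3 *)

Lemma sum_ord3 (V : nmodType) (F : 'I_3 -> V) : \sum_i F i = F 0 + F 1 + F 2.
Proof.
rewrite !big_ord_recr big_ord0 /= add0r.
by congr (F _ + F _ + F _); exact: val_inj.
Qed.

Lemma forall_ord3 (P : 'I_3 -> Prop) : P 0 -> P 1 -> P 2 -> forall i, P i.
Proof.
move=> P0 P1 P2 [[|[|[|//]]] i3].
- by rewrite (_ : Ordinal i3 = 0) //; exact: val_inj.
- by rewrite (_ : Ordinal i3 = 1) //; exact: val_inj.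
- by rewrite (_ : Ordinal i3 = 2) //; exact: val_inj.
Qed.

Lemma addr_ord3 : ((0 + 1 = 1 :> 'I_3) * (0 + 2 = 2 :> 'I_3) *
  (1 + 1 = 2 :> 'I_3) * (1 + 2 = 0 :> 'I_3) *
  (2 + 1 = 0 :> 'I_3) * (2 + 2 = 1 :> 'I_3)).
Proof. by do !split; exact: val_inj. Qed.

Lemma lift_ord3 : ((lift 0 (0 : 'I_2) = 1 :> 'I_3) *
  (lift 0 (1 : 'I_2) = 2 :> 'I_3) * (lift 1 (0 : 'I_2) = 0 :> 'I_3) *
  (lift 1 (1 : 'I_2) = 2 :> 'I_3) * (lift 2 (0 : 'I_2) = 0 :> 'I_3) *
  (lift 2 (1 : 'I_2) = 1 :> 'I_3)).
Proof. by do !split; exact: val_inj. Qed.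

Lemma det_mx22 (K : comNzRingType) (A : 'M[K]_2) :
  \det A = A 0 0 * A 1 1 - A 0 1 * A 1 0.
Proof.
rewrite (expand_det_row _ 0) !big_ord_recr big_ord0 /= add0r.
rewrite /cofactor !det_mx11 !mxE /=.
have -> : widen_ord (leqnSn 1) ord_max = 0 :> 'I_2 by exact: val_inj.
have -> : ord_max = 1 :> 'I_2 by exact: val_inj.
have -> : lift 0 (0 : 'I_1) = 1 :> 'I_2 by exact: val_inj.
have -> : lift 1 (0 : 'I_1) = 0 :> 'I_2 by exact: val_inj.
by rewrite /= addn0 expr0 expr1 mul1r mulN1r mulrN.
Qed.

(* In dimension 3, indexing the minors cyclically absorbs the sign
   [(-1) ^+ (i + j)]. *)
Lemma cofactor_mx33 (K : comNzRingType) (A : 'M[K]_3) (i j : 'I_3) :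
  cofactor A i j = A (i + 1) (j + 1) * A (i + 2) (j + 2)
                 - A (i + 1) (j + 2) * A (i + 2) (j + 1).
Proof.
rewrite /cofactor det_mx22 !mxE -signr_odd.
elim/forall_ord3: i; elim/forall_ord3: j; rewrite ?lift_ord3 ?addr_ord3;
  (rewrite (_ : odd _ = false); last by []) ||
  (rewrite (_ : odd _ = true); last by []); rewrite /= ?expr0 ?expr1; ring.
Qed.

Lemma det_mx33 (K : comNzRingType) (A : 'M[K]_3) :
  \det A = A 0 0 * (A 1 1 * A 2 2 - A 1 2 * A 2 1)
         + A 0 1 * (A 1 2 * A 2 0 - A 1 0 * A 2 2)
         + A 0 2 * (A 1 0 * A 2 1 - A 1 1 * A 2 0).
Proof. by rewrite (expand_det_row _ 0) sum_ord3 !cofactor_mx33 ?addr_ord3. Qed.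

(** Cayley-Hamilton divided by [A]: a product with [A] gives the characteristic equation, but this
    form also holds for singular [A]. *)
Lemma adj_mx33 (K : comNzRingType) (A : 'M[K]_3) :
  \adj A = A *m A - \tr A *: A + (\tr (\adj A))%:M.
Proof.
apply/matrixP => i j; rewrite /mxtrace !(sum_ord3, mxE) !cofactor_mx33.
elim/forall_ord3: i; elim/forall_ord3: j;
  rewrite ?addr_ord3 /= ?mulr1n ?mulr0n; ring.
Qed.

Lemma det_add_scalar_mx33 (K : comNzRingType) (a b : K) (A : 'M[K]_3) :
  \det (a%:M + b *: A) =
  a ^+ 3 + a ^+ 2 * b * \tr A + a * b ^+ 2 * \tr (\adj A) + b ^+ 3 * \det A.
Proof.
rewrite !det_mx33 /mxtrace !(sum_ord3, mxE) !cofactor_mx33 ?addr_ord3 /=.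
rewrite ?mulr1n ?mulr0n; ring.
Qed.

(** * Algebra of a single rotation *)

Section rotation_algebra.
Context {R : realType}.
Implicit Types (Q : 'M[R]_3) (a b c : R).

Lemma SO3_mulTmx Q : SO3 Q -> Q^T *m Q = 1%:M.
Proof. by move=> [QQT _]; exact: mulmx1C. Qed.

Lemma SO3_adj Q : SO3 Q -> \adj Q = Q^T.
Proof.
move=> SQ; have [_ dQ] := SQ.
by rewrite -[LHS]mul1mx -(SO3_mulTmx SQ) -mulmxA mul_mx_adj dQ mulmx1.
Qed.

(* Cayley-Hamilton for a rotation, divided by [Q]. *)
Lemma SO3_sqr Q : SO3 Q -> Q *m Q = \tr Q *: Q - (\tr Q)%:M + Q^T.
Proof.
move=> SQ; have := adj_mx33 Q; rewrite (SO3_adj SQ) mxtrace_tr => ->.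
by apply/matrixP => i j; rewrite !mxE; ring.
Qed.

Lemma SO3_trace_sqr Q : SO3 Q -> \tr (Q *m Q) = \tr Q ^+ 2 - 2 * \tr Q.
Proof.
move=> SQ; rewrite (SO3_sqr SQ) linearD linearB /= linearZ /= mxtrace_scalar.
by rewrite mxtrace_tr; ring.
Qed.

Lemma mxtrace_mulmx_trmx m n (A : 'M[R]_(m, n)) :
  \tr (A *m A^T) = \sum_i \sum_j A i j ^+ 2.
Proof.
by apply: eq_bigr => i _; rewrite mxE; apply: eq_bigr => j _; rewrite mxE expr2.
Qed.

Lemma SO3_sqr_dist1 Q : SO3 Q ->
  \sum_i \sum_j ((Q - 1%:M) i j) ^+ 2 = 2 * (3 - \tr Q).
Proof.
move=> SQ; have [QQT _] := SQ; rewrite -mxtrace_mulmx_trmx.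
rewrite linearB /= trmx1 mulmxBr mulmxBl QQT mulmx1 mul1mx !linearB /=.
by rewrite mxtrace_tr !mxtrace1; ring.
Qed.

Lemma SO3_trace_le3 Q : SO3 Q -> \tr Q <= 3.
Proof.
move=> /SO3_sqr_dist1 E.
have : 0 <= 2 * (3 - \tr Q).
  by rewrite -E; do 2![apply: sumr_ge0 => ? _]; exact: sqr_ge0.
lra.
Qed.

(** The squared Frobenius norm of [Q - Q^T] equals [2 * (3 - \tr Q) * (1 + \tr Q)], and the first
    factor in the trace is already known to be nonnegative. *)
Lemma SO3_trace_geN1 Q : SO3 Q -> -1 <= \tr Q.
Proof.
move=> SQ; have [QQT _] := SQ.
have : 0 <= \tr ((Q - Q^T) *m (Q - Q^T)^T).
  rewrite mxtrace_mulmx_trmx.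
  by do 2![apply: sumr_ge0 => ? _]; exact: sqr_ge0.
rewrite linearB /= trmxK mulmxBr !mulmxBl QQT (SO3_mulTmx SQ) !linearB /=.
rewrite -trmx_mul mxtrace_tr (SO3_trace_sqr SQ) mxtrace1 => tr_ge0.
by have := SO3_trace_le3 SQ; nra.
Qed.

Lemma mxtrace_attitude_error_field Q : SO3 Q ->
  \tr (attitude_error_field Q) = (3 - \tr Q) * (1 + \tr Q) / 2.
Proof.
move=> SQ; have [QQT _] := SQ.
rewrite linearN /= -scalemxAr linearZ /= mulmxBr QQT linearB /=.
by rewrite (SO3_trace_sqr SQ) mxtrace1; field.
Qed.

(** By Cayley-Hamilton these combinations are closed under products, so identities along the flow
    line through [Q] reduce to identities between coefficients. *)
Definition rot_comb Q a b c : 'M[R]_3 := a%:M + b *: Q + c *: Q^T.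

Lemma rot_combM Q a b c a' b' c' : SO3 Q ->
  rot_comb Q a b c *m rot_comb Q a' b' c' =
  rot_comb Q (a * a' + b * c' + c * b' - \tr Q * (b * b' + c * c'))
             (a * b' + b * a' + c * c' + \tr Q * (b * b'))
             (a * c' + c * a' + b * b' + \tr Q * (c * c')).
Proof.
move=> SQ; have [QQT _] := SQ; rewrite /rot_comb.
have QTQT : Q^T *m Q^T = \tr Q *: Q^T - (\tr Q)%:M + Q.
  rewrite -trmx_mul (SO3_sqr SQ) linearD linearB /= linearZ /=.
  by rewrite tr_scalar_mx trmxK.
rewrite !mulmxDl !mulmxDr -!scalemxAl -!scalemxAr !mul_scalar_mx !mul_mx_scalar.
rewrite QQT (SO3_mulTmx SQ) QTQT (SO3_sqr SQ).
by apply/matrixP => i j; rewrite !mxE -[RHS]addrA; case: (i == j) => /=; ring.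
Qed.

Lemma trmx_rot_comb Q a b c : (rot_comb Q a b c)^T = rot_comb Q a c b.
Proof.
by rewrite /rot_comb !linearD /= !linearZ /= trmxK tr_scalar_mx addrAC.
Qed.

Lemma skew_part_rot_comb Q a b c :
  skew_part (rot_comb Q a b c) = rot_comb Q 0 ((b - c) / 2) ((c - b) / 2).
Proof.
rewrite /skew_part trmx_rot_comb /rot_comb.
by apply/matrixP => i j; rewrite !mxE; case: (i == j) => /=; field.
Qed.

Lemma rot_combN Q a b c : - rot_comb Q a b c = rot_comb Q (- a) (- b) (- c).
Proof.
by apply/matrixP => i j; rewrite !mxE; case: (i == j) => /=; ring.
Qed.

Lemma rot_comb100 Q : rot_comb Q 1 0 0 = 1%:M.
Proof. by rewrite /rot_comb !scale0r !addr0. Qed.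

Lemma rot_comb010 Q : rot_comb Q 0 1 0 = Q.
Proof. by rewrite /rot_comb scale1r scale0r addr0 raddf0 add0r. Qed.

(** The polynomial is symmetric in [a] and [b] because [Q] and its adjugate [Q^T] have the same
    trace and [\det Q = 1]. *)
Lemma det_rot_comb Q a b : SO3 Q ->
  \det (rot_comb Q a b 0) =
  a ^+ 3 + a ^+ 2 * b * \tr Q + a * b ^+ 2 * \tr Q + b ^+ 3.
Proof.
move=> SQ; have [_ dQ] := SQ.
rewrite /rot_comb scale0r addr0 det_add_scalar_mx33 (SO3_adj SQ) mxtrace_tr.
by rewrite dQ mulr1.
Qed.

End rotation_algebra.

(** * Derivatives of matrix-valued and real functions *)

Lemma is_derive_mxP {R : realFieldType} {V : normedModType R} m n
    (M : V -> 'M[R]_(m, n)) (dM : 'M[R]_(m, n)) t v :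
  is_derive t v M dM <->
  forall i j, is_derive t v (fun x => M x i j) (dM i j).
Proof.
split=> [[Md <-] i j|Md].
  rewrite derive_mx // mxE; apply: derivableP.
  by move/derivable_mxP: Md => /(_ i j).
have dM' : derivable M t v by apply/derivable_mxP => i j; case: (Md i j).
split=> //; rewrite derive_mx //; apply/matrixP => i j; rewrite mxE.
by case: (Md i j).
Qed.

Lemma eq_is_derive {R : numFieldType} {V W : normedModType R} (f g : V -> W)
    (x v : V) (df dg : W) :
  is_derive x v f df -> f =1 g -> df = dg -> is_derive x v g dg.
Proof. by move=> dfx /funext <- <-. Qed.

(* Pointwise versions of the derivation rules for real functions, free of the
   function ring and of scalar multiplication. *)
Section real_derive.
Context {R : realType}.
Implicit Types f g : R -> R.

Lemma is_derive_cmul f (c x df : R) :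
  is_derive x 1 f df -> is_derive x 1 (fun s => c * f s) (c * df).
Proof. exact: is_deriveZ. Qed.

Lemma is_derive_add f g (x df dg : R) :
  is_derive x 1 f df -> is_derive x 1 g dg ->
  is_derive x 1 (fun s => f s + g s) (df + dg).
Proof. exact: is_deriveD. Qed.

Lemma is_derive_sub f g (x df dg : R) :
  is_derive x 1 f df -> is_derive x 1 g dg ->
  is_derive x 1 (fun s => f s - g s) (df - dg).
Proof. exact: is_deriveB. Qed.

Lemma is_derive_csub f (c x df : R) :
  is_derive x 1 f df -> is_derive x 1 (fun s => c - f s) (- df).
Proof.
move=> dfx; rewrite -[X in is_derive _ _ _ X]sub0r.
by apply: is_derive_sub => //; exact: is_derive_cst.
Qed.

Lemma is_derive_mul f g (x df dg : R) :
  is_derive x 1 f df -> is_derive x 1 g dg ->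
  is_derive x 1 (fun s => f s * g s) (f x * dg + g x * df).
Proof. exact: is_deriveM. Qed.

Lemma is_derive_inv f (x df : R) :
  is_derive x 1 f df -> f x != 0 ->
  is_derive x 1 (fun s => (f s)^-1) (- (f x) ^- 2 * df).
Proof. by move=> df0 fx0; exact: is_deriveV. Qed.

Lemma is_derive_expR_cmul (c x : R) :
  is_derive x 1 (fun s : R => expR (c * s)) (expR (c * x) * c).
Proof.
apply: is_derive1_comp; rewrite -[X in is_derive _ _ _ X]mulr1.
exact: is_derive_cmul.
Qed.

End real_derive.

(** * Explicit solutions from every initial rotation *)

Section flow.
Context {R : realType}.
Implicit Types (Q : 'M[R]_3) (k t : R).

Lemma is_derive_rot_comb Q (a b c : R -> R) (da db dc t : R) :
  is_derive t 1 a da -> is_derive t 1 b db -> is_derive t 1 c dc ->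
  is_derive t 1 (fun s => rot_comb Q (a s) (b s) (c s)) (rot_comb Q da db dc).
Proof.
move=> Da Db Dc; apply/is_derive_mxP => i j.
have dab := is_derive_add (is_derive_cmul (i == j)%:R Da)
  (is_derive_cmul (Q i j) Db).
apply: (eq_is_derive (is_derive_add dab (is_derive_cmul (Q j i) Dc))) => [s|].
all: by rewrite !mxE; case: (i == j) => /=; ring.
Qed.

(* A rotation [Q] by the angle [th] about an axis [v], where
   [k = (1 + \tr Q) / 2 = 1 + cos th], is moved by the flow to the rotation
   about [v] by the angle [ph] with [sin ph = flow_sin k t * sin th] and
   [1 - cos ph = flow_ver k t * (1 - cos th)]. *)
Definition flow_sin k t : R := 2 * ((2 - k) * expR (- t) + k * expR t)^-1.

Definition flow_ver k t : R := expR (- t) * flow_sin k t.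

(** Rodrigues' formula for the angle [ph], where [tan (ph / 2) = expR (- t) * tan (th / 2)] solves
    [ph' = - sin ph]. Using the ratios of sines and of versines avoids dividing by [sin th], so
    identity and half-turns need no separate case. *)
Definition flow Q t : 'M[R]_3 :=
  let k := (1 + \tr Q) / 2 in
  let p := flow_sin k t in let q := flow_ver k t in
  rot_comb Q (1 - q) ((p + q) / 2) ((q - p) / 2).

Lemma flow_den_gt0 k t : 0 <= k <= 2 ->
  0 < (2 - k) * expR (- t) + k * expR t.
Proof.
move=> /andP[k0 k2]; have := expR_gt0 t; have := expR_gt0 (- t); nra.
Qed.

(** This is [sin^2 ph = (1 - cos ph) (1 + cos ph)] divided by [1 - cos th = 2 - k]. *)
Lemma flow_sinE k t : 0 <= k <= 2 ->
  flow_sin k t ^+ 2 * k = flow_ver k t * (2 - (2 - k) * flow_ver k t).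
Proof.
move=> k02; have := mulVf (lt0r_neq0 (flow_den_gt0 t k02)).
rewrite /flow_ver /flow_sin.
have := expRxMexpNx_1 t.
move: (expR t) (expR (- t)) => w u wu; set D := (_ + _)^-1 => DE.
transitivity ((2 * D) ^+ 2 * k * (w * u)); first by rewrite wu mulr1.
transitivity (u * (2 * D) * (2 * (D * ((2 - k) * u + k * w)) -
  (2 - k) * (u * (2 * D)))); first by ring.
by rewrite DE mulr1.
Qed.

Lemma is_derive_expRN t :
  is_derive t 1 (fun s : R => expR (- s)) (- expR (- t)).
Proof.
apply: (eq_is_derive (is_derive_expR_cmul (-1) t)) => [s|]; rewrite mulN1r //.
by rewrite mulrN1.
Qed.

(** This is [(sin ph)' = - sin ph * cos ph] divided by [sin th], with
    [cos ph = 1 - (2 - k) * flow_ver k t]. *)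
Lemma is_derive_flow_sin k t : 0 <= k <= 2 ->
  is_derive t 1 (flow_sin k) (- flow_sin k t * (1 - (2 - k) * flow_ver k t)).
Proof.
move=> k02; have D0 := lt0r_neq0 (flow_den_gt0 t k02).
have dD := is_derive_add (is_derive_cmul (2 - k) (is_derive_expRN t))
  (is_derive_cmul k (is_derive_expR t)).
apply: (eq_is_derive (is_derive_cmul 2 (is_derive_inv dD D0))) => //.
rewrite /flow_ver /flow_sin; move: (expR t) (expR (- t)) D0 => w u D0; field.
exact: D0.
Qed.

Lemma is_derive_flow_ver k t : 0 <= k <= 2 ->
  is_derive t 1 (flow_ver k) (- (flow_sin k t ^+ 2 * k)).
Proof.
move=> k02; have dp := is_derive_flow_sin t k02.
apply: (eq_is_derive (is_derive_mul (is_derive_expRN t) dp)) => //.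
by rewrite flow_sinE // /flow_ver; ring.
Qed.

Lemma SO3_flow_range Q : SO3 Q -> 0 <= (1 + \tr Q) / 2 <= 2.
Proof.
move=> SQ; have := SO3_trace_le3 SQ; have := SO3_trace_geN1 SQ.
by move=> ? ?; apply/andP; split; lra.
Qed.

Lemma is_derive_flow Q t : SO3 Q ->
  is_derive t 1 (flow Q) (attitude_error_field (flow Q t)).
Proof.
move=> SQ; have k02 := SO3_flow_range SQ.
pose k := (1 + \tr Q) / 2.
have dp := is_derive_flow_sin t k02; have dq := is_derive_flow_ver t k02.
have -> : attitude_error_field (flow Q t) =
    let p := flow_sin k t in let q := flow_ver k t in
    let dp := - p * (1 - (2 - k) * q) in let dq := - (p ^+ 2 * k) in
    rot_comb Q (- dq) ((dp + dq) / 2) ((dq - dp) / 2).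
  rewrite /attitude_error_field /flow skew_part_rot_comb rot_combM //.
  rewrite rot_combN /=.
  by congr rot_comb; rewrite /k; field.
apply: is_derive_rot_comb.
- exact: is_derive_csub dq.
- by apply: (eq_is_derive (is_derive_cmul 2^-1 (is_derive_add dp dq))) => [s|];
    rewrite mulrC.
- by apply: (eq_is_derive (is_derive_cmul 2^-1 (is_derive_sub dq dp))) => [s|];
    rewrite mulrC.
Qed.

Lemma flow0 Q : flow Q 0 = Q.
Proof.
rewrite -[RHS]rot_comb010 /flow /flow_ver /flow_sin oppr0 expR0.
rewrite !mulr1 subrK divff ?pnatr_eq0 // mulr1.
by congr rot_comb; field.
Qed.

Lemma SO3_flow Q t : SO3 Q -> SO3 (flow Q t).
Proof.
move=> SQ; have k02 := SO3_flow_range SQ; split.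
  rewrite /flow trmx_rot_comb rot_combM // -(rot_comb100 Q).
  have := flow_sinE t k02; set p := flow_sin _ _; set q := flow_ver _ _ => pq.
  by congr rot_comb; lra.
pose u := expR (- t).
have det_comm : \det (rot_comb Q (1 - u) (1 + u) 0) =
    \det (rot_comb Q (1 + u) (1 - u) 0).
  by rewrite !det_rot_comb //; ring.
have det_gt0 : 0 < \det (rot_comb Q (1 + u) (1 - u) 0).
  rewrite det_rot_comb //.
  have -> : (1 + u) ^+ 3 + (1 + u) ^+ 2 * (1 - u) * \tr Q +
      (1 + u) * (1 - u) ^+ 2 * \tr Q + (1 - u) ^+ 3 =
      4 * u * ((2 - (1 + \tr Q) / 2) * u + (1 + \tr Q) / 2 * expR t).
    have ue : u * expR t = 1 by rewrite mulrC expRxMexpNx_1.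
    transitivity (4 * u * ((2 - (1 + \tr Q) / 2) * u) + 2 * (1 + \tr Q) *
      (u * expR t)).
      by rewrite ue; field.
    by field.
  by rewrite !mulr_gt0 ?expR_gt0 // flow_den_gt0.
(* The Cayley-type form [flow Q t = A *m B^-1] of the Riccati solution, with
   [A = Q *m B^T]. *)
have /(congr1 determinant) : flow Q t *m rot_comb Q (1 + u) (1 - u) 0 =
    rot_comb Q (1 - u) (1 + u) 0.
  rewrite /flow rot_combM // /flow_ver /flow_sin -/u.
  have D0 := lt0r_neq0 (flow_den_gt0 t k02); rewrite -/u in D0.
  have eu : expR t = u^-1 by rewrite /u expRN invrK.
  rewrite eu in D0 *.
  have u0 : u != 0 by rewrite /u expR_eq0.
  move: (\tr Q) (u) u0 D0 => tau {eu det_comm det_gt0}u u0 D0.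
  (* The flow denominator multiplied by [2 * u], which clears its inverse and its halves for
     [field]. *)
  have D1 : (4 - (1 + tau)) * u * u + (1 + tau) != 0.
    apply: contra_neq D0 => D1.
    transitivity (((4 - (1 + tau)) * u * u + (1 + tau)) / (2 * u)).
      by field.
    by rewrite D1 mul0r.
  by congr rot_comb; field; rewrite u0 D1.
rewrite det_mulmx det_comm => /(canRL (mulfK (lt0r_neq0 det_gt0))) ->.
by rewrite divff // lt0r_neq0.
Qed.

End flow.

(** * Stability and convergence through the trace *)

Section attraction.
Context {R : realType}.
Implicit Types (Q A : 'M[R]_3) (x : R -> 'M[R]_3).

Lemma ler_mx_norm_coord m n (A : 'M[R]_(m, n)) i j : `|A i j| <= `|A|.
Proof.
by rewrite [leRHS]/Num.norm /= mx_normrE; exact: (le_bigmax _ _ (i, j)).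
Qed.

(** The norm is the largest absolute value of an entry, so its square is one of the summands. *)
Lemma sqr_mx_norm_le m n (A : 'M[R]_(m, n)) :
  `|A| ^+ 2 <= \sum_i \sum_j A i j ^+ 2.
Proof.
have sum_ge0 i : 0 <= \sum_j A i j ^+ 2.
  by apply: sumr_ge0 => j _; exact: sqr_ge0.
have [A0|/mx_norm_neq0[[i j] Aij]] := eqVneq (mx_norm A) 0.
  by rewrite [`|A|]A0 expr0n sumr_ge0.
rewrite [`|A|]Aij /= real_normK ?num_real //.
rewrite (bigD1 i) //= (bigD1 j) //= -addrA lerDl addr_ge0 //.
  by apply: sumr_ge0 => ? _; exact: sqr_ge0.
exact: sumr_ge0.
Qed.

Lemma SO3_sqr_norm_dist1 Q : SO3 Q -> `|Q - 1%:M| ^+ 2 <= 2 * (3 - \tr Q).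
Proof. by move=> SQ; rewrite -SO3_sqr_dist1 //; exact: sqr_mx_norm_le. Qed.

Lemma trace_deficit_le A : 3 - \tr A <= 3 * `|A - 1%:M|.
Proof.
have le_coord i : 1 - A i i <= `|A - 1%:M|.
  rewrite (le_trans _ (ler_mx_norm_coord (A - 1%:M) i i)) // !mxE eqxx.
  by rewrite distrC ler_norm.
have := le_coord 0; have := le_coord 1; have := le_coord 2.
by rewrite /mxtrace sum_ord3; lra.
Qed.

Lemma continuous_mxtrace3 : continuous (fun A : 'M[R]_3 => \tr A).
Proof.
have -> : (fun A : 'M[R]_3 => \tr A) = fun A => A 0 0 + A 1 1 + A 2 2.
  by apply/funext => A; rewrite /mxtrace sum_ord3.
move=> A; have cA i := @coord_continuous R 3 3 i i A.
exact: (cvgD (cvgD (cA 0) (cA 1)) (cA 2)).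
Qed.

Section trajectory.
Variable x : R -> 'M[R]_3.
Hypothesis traj : trajectory (@SO3 R) attitude_error_field x.

Lemma is_derive_trajectory_trace (t : R) : 0 < t ->
  is_derive t 1 (fun s => \tr (x s)) ((3 - \tr (x t)) * (1 + \tr (x t)) / 2).
Proof.
move=> t0; have [SX _ /(_ t t0)/is_derive_mxP dx] := traj.
rewrite -mxtrace_attitude_error_field; last exact/SX/ltW.
have d01 := is_derive_add (dx 0 0) (dx 1 1).
apply: (eq_is_derive (is_derive_add d01 (dx 2 2))).
  by move=> s; rewrite /mxtrace sum_ord3.
by rewrite /mxtrace sum_ord3.
Qed.

Lemma continuous_trajectory_trace :
  {within `[0, +oo[, continuous (fun s => \tr (x s))}.
Proof.
have [_ cx _] := traj.
by move=> t; apply: continuous_comp; [exact: cx|exact: continuous_mxtrace3].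
Qed.

Lemma trajectory_trace_ge0 (t : R) : 0 <= t -> \tr (x 0) <= \tr (x t).
Proof.
move=> t0; have [SX _ _] := traj.
apply: (@ger0_derive1_ndecry _ (fun s => \tr (x s)) 0) => //.
- move=> s; rewrite in_itv /= andbT => /is_derive_trajectory_trace; by case.
- move=> s; rewrite in_itv /= andbT => s0; rewrite derive1E.
  have [_ ->] := is_derive_trajectory_trace s0.
  have := SO3_trace_le3 (SX _ (ltW s0)); have := SO3_trace_geN1 (SX _ (ltW s0)).
  by move=> ? ?; rewrite divr_ge0 // mulr_ge0 //; lra.
- exact: continuous_trajectory_trace.
Qed.

(* [3 - \tr] decays at rate at least [(1 + \tr (x 0)) / 2], as the trace
   increases. *)
Lemma trajectory_trace_decay (t : R) : 0 <= t ->
  expR ((1 + \tr (x 0)) / 2 * t) * (3 - \tr (x t)) <= 3 - \tr (x 0).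
Proof.
move=> t0; have [SX _ _] := traj; pose k := (1 + \tr (x 0)) / 2.
(* With this integrating factor, the derivative has the sign of [\tr (x 0) - \tr (x s)], which is
   nonpositive by monotonicity of the trace. *)
pose W (s : R) := expR (k * s) * (3 - \tr (x s)).
have dW (s : R) : 0 < s -> is_derive s 1 W
    (expR (k * s) * ((3 - \tr (x s)) * (\tr (x 0) - \tr (x s)) / 2)).
  move=> s0; have dV := is_derive_csub 3 (is_derive_trajectory_trace s0).
  apply: (eq_is_derive (is_derive_mul (is_derive_expR_cmul k s) dV)) => [//|].
  by rewrite /k; field.
have -> : 3 - \tr (x 0) = W 0 by rewrite /W mulr0 expR0 mul1r.
apply: (@ler0_derive1_nincry R W 0 _ _ _ 0 t (lexx _) t0) => [s|s|].
- by rewrite in_itv /= andbT => /dW [].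
- rewrite in_itv /= andbT => s0; rewrite derive1E.
  have [_ ->] := dW _ s0; rewrite pmulr_rle0 ?expR_gt0 //.
  have := SO3_trace_le3 (SX _ (ltW s0)); have := trajectory_trace_ge0 (ltW s0).
  by move=> ? ?; nra.
- move=> s; apply: cvgM.
    apply: continuous_subspaceT => {}s.
    by have [/derivable1_diffP/differentiable_continuous] :=
      is_derive_expR_cmul k s.
  by apply: cvgB; [exact: cvg_cst|exact: continuous_trajectory_trace].
Qed.

End trajectory.

Lemma SO3_1 : SO3 (1%:M : 'M[R]_3).
Proof. by split; rewrite ?trmx1 ?mulmx1 ?det1. Qed.

Lemma equilibrium1 : equilibrium (@SO3 R) attitude_error_field 1%:M.
Proof.
split; first exact: SO3_1.
by rewrite /attitude_error_field /skew_part trmx1 subrr scaler0 mulmx0 oppr0.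
Qed.

Lemma forward_complete_SO3 : forward_complete (@SO3 R) attitude_error_field.
Proof.
move=> Q SQ; exists (flow Q); last exact: flow0.
split=> [t _||t _]; [exact: SO3_flow| |exact: is_derive_flow].
apply: continuous_subspaceT => t.
by have [/derivable1_diffP/differentiable_continuous] := is_derive_flow t SQ.
Qed.

Lemma lyapunov_stable1 : lyapunov_stable (@SO3 R) attitude_error_field 1%:M.
Proof.
(* The squared distance at time [t] is at most [2 * (3 - \tr (x t))], hence at most
   [2 * (3 - \tr (x 0))], hence at most 6 times the initial distance. *)
move=> e e0; exists (e ^+ 2 / 6) => [|x traj x0 t t0].
  by rewrite divr_gt0 ?exprn_gt0.
have [SX _ _] := traj.
rewrite -(ltr_pXn2r (_ : 0 < 2)%N) ?nnegrE ?(ltW e0) //.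
have := SO3_sqr_norm_dist1 (SX t t0); have := trace_deficit_le (x 0).
by have := trajectory_trace_ge0 traj t0; lra.
Qed.

Lemma trajectory_cvg1 x : trajectory (@SO3 R) attitude_error_field x ->
  -1 < \tr (x 0) -> x t @[t --> +oo] --> (1%:M : 'M[R]_3).
Proof.
move=> traj tr0; have [SX _ _] := traj; pose k := (1 + \tr (x 0)) / 2.
have k0 : 0 < k by rewrite /k; lra.
apply/cvgrPdist_lt => e e0; near=> t.
have t0 : 0 <= t by near: t; apply: nbhs_pinfty_ge; exact: num_real.
(* The 8 is twice 4, the largest value of [3 - \tr (x 0)]; the exponential is bounded below by
   [1 + k * t]. *)
have tlarge : 8 / (e ^+ 2 * k) < t.
  by near: t; apply: nbhs_pinfty_gt; exact: num_real.
have e2 : 0 < e ^+ 2 by rewrite exprn_gt0.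
have kt : 8 < e ^+ 2 * (k * t).
  by rewrite mulrA mulrC -ltr_pdivrMr // mulr_gt0.
rewrite distrC -(ltr_pXn2r (_ : 0 < 2)%N) ?nnegrE ?(ltW e0) //.
have nle := SO3_sqr_norm_dist1 (SX t t0).
have := trajectory_trace_decay traj t0; rewrite -/k.
have := SO3_trace_geN1 (SX 0 (lexx _)); have := expR_ge1Dx (k * t).
have := expR_gt0 (k * t); move: (expR _) => w w0 wge trge decay.
rewrite -(ltr_pM2l w0).
have : w * `|x t - 1%:M| ^+ 2 <= w * (2 * (3 - \tr (x t))) by rewrite ler_pM2l.
have : e ^+ 2 * (1 + k * t) <= e ^+ 2 * w by rewrite ler_pM2l.
lra.
Unshelve. all: by end_near. Qed.

End attraction.

(** * Density of the rotations of trace above -1 *)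

Section density.
Context {R : realType}.
Implicit Types (Q : 'M[R]_3) (i : 'I_3) (c s : R).

(* The rotation about the [i]-th coordinate axis by an angle of cosine [c] and
   sine [s]. *)
Definition axis_rot i c s : 'M[R]_3 :=
  \matrix_(r, t) if r == i then (t == i)%:R else if t == i then 0 else
    if r == t then c else if r == i + 1 then - s else s.

Lemma SO3_axis_rot i c s : c ^+ 2 + s ^+ 2 = 1 -> SO3 (axis_rot i c s).
Proof.
move=> cs; split; last first.
  by rewrite det_mx33 !mxE; elim/forall_ord3: i; rewrite ?addr_ord3 /=; lra.
apply/matrixP => r t; rewrite !mxE sum_ord3 !mxE.
elim/forall_ord3: i; elim/forall_ord3: r; elim/forall_ord3: t;
  rewrite ?addr_ord3 /= ?mulr1n ?mulr0n; lra.
Qed.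

Lemma mxtrace_axis_rot i c s : \tr (axis_rot i c s) = 1 + 2 * c.
Proof.
rewrite /mxtrace sum_ord3 !mxE.
by elim/forall_ord3: i; rewrite ?addr_ord3 /=; ring.
Qed.

(** Adding the two senses of rotation cancels the sine terms, so one of the senses has trace at
    least the average. *)
Lemma mxtrace_mul_axis_rot Q i c s :
  \tr (Q *m axis_rot i c s) + \tr (Q *m axis_rot i c (- s)) =
  2 * (Q i i + c * (\tr Q - Q i i)).
Proof.
rewrite /mxtrace !sum_ord3 !mxE !sum_ord3 !mxE.
by elim/forall_ord3: i; rewrite ?addr_ord3 /=; ring.
Qed.

Lemma SO3_mulmx Q Q' : SO3 Q -> SO3 Q' -> SO3 (Q *m Q').
Proof.
move=> [QQT dQ] [QQT' dQ']; split; last by rewrite det_mulmx dQ dQ' mulr1.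
by rewrite trmx_mul mulmxA -(mulmxA Q) QQT' mulmx1.
Qed.

(** Left multiplication by a rotation preserves the Frobenius norm, so [Q *m (Q' - 1%:M)] is as
    large as [Q' - 1%:M]. *)
Lemma SO3_sqr_norm_distM Q Q' : SO3 Q -> SO3 Q' ->
  `|Q *m Q' - Q| ^+ 2 <= 2 * (3 - \tr Q').
Proof.
move=> SQ SQ'; apply: le_trans (sqr_mx_norm_le _) _.
rewrite -SO3_sqr_dist1 // -!mxtrace_mulmx_trmx -{2 4}[Q]mulmx1 -mulmxBr.
by rewrite trmx_mul -mulmxA mxtrace_mulC -!mulmxA SO3_mulTmx // mulmx1.
Qed.

Lemma SO3_trace_gtN1_near Q (e : R) : SO3 Q -> 0 < e ->
  exists Q', [/\ SO3 Q', -1 < \tr Q' & `|Q' - Q| < e].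
Proof.
move=> SQ e0; have := SO3_trace_geN1 SQ; rewrite le_eqVlt => /predU1P[trQ|trQ].
  (* Three diagonal entries with sum -1 cannot all be at most -1. *)
  have [i Qi] : exists i, -1 < Q i i.
    have := trQ; rewrite /mxtrace sum_ord3 => trQ3.
    have [|Q0] := ltP (-1) (Q 0 0); first by exists 0.
    have [|Q1] := ltP (-1) (Q 1 1); first by exists 1.
    by exists 2; lra.
  (* With cosine [1 - d] the squared displacement is at most [4 * d], below [e ^+ 2]; [d <= 1] keeps
     the square root for the sine legitimate. *)
  pose d := Num.min 1 (e ^+ 2 / 8).
  have e2 : 0 < e ^+ 2 by rewrite exprn_gt0.
  have d0 : 0 < d by rewrite lt_min ltr01 divr_gt0.
  have d1 : d <= 1 by rewrite ge_min lexx.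
  have de : d <= e ^+ 2 / 8 by rewrite ge_min lexx orbT.
  pose c := 1 - d; pose s := Num.sqrt (1 - c ^+ 2).
  have cs : c ^+ 2 + s ^+ 2 = 1.
    by rewrite sqr_sqrtr; [ring|rewrite /c; nra].
  have near1 s' : c ^+ 2 + s' ^+ 2 = 1 -> `|Q *m axis_rot i c s' - Q| < e.
    move=> cs'; rewrite -(ltr_pXn2r (_ : 0 < 2)%N) ?nnegrE ?(ltW e0) //.
    apply: le_lt_trans (SO3_sqr_norm_distM SQ (SO3_axis_rot i cs')) _.
    by rewrite mxtrace_axis_rot /c; lra.
  have cNs : c ^+ 2 + (- s) ^+ 2 = 1 by rewrite sqrrN.
  have tr_sum := mxtrace_mul_axis_rot Q i c s.
  (* As [\tr Q = -1], the average of the two traces is [-1 + d * (1 + Q i i)], which exceeds -1. *)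
  have : -2 < 2 * (Q i i + c * (\tr Q - Q i i)) by rewrite -trQ /c; nra.
  rewrite -tr_sum => tr_gt.
  have [|trs] := ltP (-1) (\tr (Q *m axis_rot i c s)).
    exists (Q *m axis_rot i c s); split=> //; last exact: near1.
    exact/SO3_mulmx/SO3_axis_rot.
  exists (Q *m axis_rot i c (- s)); split; [|by lra|exact: near1].
  exact/SO3_mulmx/SO3_axis_rot.
by exists Q; rewrite subrr normr0.
Qed.

Lemma open_dense_trace_gtN1 :
  open_dense_in (@SO3 R) (@SO3 R `&` [set Q | -1 < \tr Q]).
Proof.
split.
  exists [set Q : 'M[R]_3 | -1 < \tr Q] => //.
  apply: (@open_comp _ _ (fun Q : 'M[R]_3 => \tr Q) [set y | -1 < y]).
    by move=> Q _; exact: continuous_mxtrace3.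
  exact: open_gt.
move=> Q SQ B /nbhs_ballP[e /= e0 eB].
have [Q' [SQ' tr' near]] := SO3_trace_gtN1_near SQ e0.
by exists Q'; split=> //; apply: eB; rewrite -ball_normE /= distrC.
Qed.

End density.

Theorem theorem2 (R : realType) :
  [/\ forward_complete (@SO3 R) (@attitude_error_field R),
      equilibrium (@SO3 R) (@attitude_error_field R) 1%:M &
      almost_globally_asymptotically_stable
        (@SO3 R) (@attitude_error_field R) 1%:M].
Proof.
split; [exact: forward_complete_SO3|exact: equilibrium1|split].
  exact: lyapunov_stable1.
exists (@SO3 R `&` [set Q | -1 < \tr Q]); first exact: open_dense_trace_gtN1.
by move=> x traj [_ tr0]; exact: trajectory_cvg1.
Qed.
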